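(* Let $D$ be a pasting diagram of $k$-linear categories, $k$-linear functors and natural transformations with a single instance of composing two natural transformations or of composing a natural transformation with a functor. Then all obstructions to the deformation of $D$ are cocycles.
   Context: $k$ is a fixed commutative ground ring. Arrows are composed in diagrammatic order; $G(F)$ is the composite of $F:\mathcal A\to\mathcal B$ and $G:\mathcal B\to\mathcal C$. For $k$-linear functors $F,G:\mathcal A\to\mathcal B$, $C^n(F,G)$ (zero for $n<0$) is the module of families of $k$-multilinear maps $\phi:\mathcal A(x_0,x_1)\times\cdots\times\mathcal A(x_{n-1},x_n)\to\mathcal B(Fx_0,Gx_n)$, with $d\phi(f_0,\ldots,f_n)=F(f_0)\phi(f_1,\ldots,f_n)+\sum_{i=1}^n(-1)^i\phi(f_0,\ldots,f_{i-1}f_i,\ldots,f_n)+(-1)^{n+1}\phi(f_0,\ldots,f_{n-1})G(f_n)$. $C^\bullet(F)=C^\bullet(F,F)$, $C^\bullet(\mathcal A)=C^\bullet(\mathrm{Id}_{\mathcal A})$. Maps: $H_*\phi=H(\phi(\ldots))$; $F^*\phi(f_1,\ldots)=\phi(F(f_1),\ldots)$; for $\tau:F_1\Rightarrow F_2$, $\tau_*:C^\bullet(G,F_1)\to C^\bullet(G,F_2)$ is right multiplication, and $\tau^*:C^\bullet(F_2,G)\to C^\bullet(F_1,G)$ left multiplication, by the appropriate component of $\tau$. For $\sigma:F\Rightarrow G$, $\tau:G\Rightarrow H$ with $F,G,H:\mathcal A\to\mathcal B$ and $\nu\in C^\bullet(\mathcal B)$ (or $\nu\in C^\bullet(K)$,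 $K:\mathcal B\to\mathcal C$): $\nu\{\sigma\}(f_1,\ldots,f_n)=-\sum_i(-1)^i\nu(Ff_1,\ldots,Ff_i,\sigma,Gf_{i+1},\ldots,Gf_n)$ and $\nu\{\sigma,\tau\}(f_1,\ldots,f_n)=-\sum_{i\le j}(-1)^{i+j}\nu(Ff_1,\ldots,Ff_i,\sigma,Gf_{i+1},\ldots,Gf_j,\tau,Hf_{j+1},\ldots,Hf_n)$, with appropriate components inserted. A pasting diagram $D$ has 0-cells labeled by $k$-linear categories, 1-cells labeled by $k$-linear functors, 2-cells whose source and target are parallel composable paths of 1-cells, labeled by natural transformations between the composites, and 3-cells whose source and target are composable 2-dimensional pasting diagrams with the same boundary, asserting equality of the pasting composites. For a composable path $p$ with composite $S$, $\wp_p:\bigoplus_{F\in p}C^\bullet(F)\to C^\bullet(S)$ is projection for a single edge and $\wp_{GF}(x)=G_*\wp_F(x)+F^*\wp_G(x)$ for concatenations. For a composable 2-dimensional diagram: $\wp$ of a single 2-cell is projection; for a vertical composite $\sigma\tau$ with target category $\mathcal B$, $\wp_{\sigma\tau}(x)=\tau_*\wp_\sigma(x)+\sigma^*\wp_\tau(x)+x_{\mathcal B}\{\sigma,\tau\}$; for $\sigma_F$ (precomposition), $\wp_{\sigma_F}=F^*\wp_\sigma$; for $H(\sigma)$ (postcomposition), $\wp_{H(\sigma)}(x)=H_*\wp_\sigma(x)+\wp_H(x)\{\sigma\}$. The deformation complex $\mathfrak C^\bullet(D)$ is the direct sum of $C^{\bullet+3}(\mathcal A)$ over 0-cells, $C^{\bullet+2}(F)$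 over 1-cells, $C^{\bullet+1}(S,T)$ over 2-cells with composite source $S$ and target $T$, and $C^\bullet(S,T)$ over 3-cells with iterated source and target functors $S,T$, with differential components $-dx_{\mathcal A}$; $-F_*x_{\mathcal A}+F^*x_{\mathcal B}+dx_F$ for $F:\mathcal A\to\mathcal B$; $x_{\mathcal B}\{\sigma\}+\sigma_*\wp_S(x)-\sigma^*\wp_T(x)-dx_\sigma$ for a 2-cell $\sigma:S\Rightarrow T$ with target category $\mathcal B$; $\wp_{\mathrm{source}}(x)-\wp_{\mathrm{target}}(x)+dx_\gamma$ for a 3-cell $\gamma$. An order $n$ deformation of $D$ replaces each composition $\mu$, each arrow part $F$ and each natural transformation $\sigma$ by $\sum_{i=0}^n\mu^{(i)}\epsilon^i$, $\sum F^{(i)}\epsilon^i$, $\sum\sigma^{(i)}\epsilon^i$ over $k[\epsilon]/(\epsilon^{n+1})$ (degree 0 terms the originals, coefficients multilinear with the same sources and targets) so that associativity, functoriality, naturality and all equalities asserted by 3-cells hold. The obstruction to extending an order $m-1$ deformation to order $m$ is the element of $\mathfrak C^0(D)$ with coordinates $-R_{\mathcal A}$, $R_F$, $-R_\sigma$, $R_\gamma$, where $R$ is the coefficient of $\epsilon^m$, with all degree $m$ terms set to 0, of: $\mu(\mu(a,b),c)-\mu(a,\mu(b,c))$ for each category; $F(\mu(a,b))-\nu(F(a),F(b))$ for each functor $F:(\mathcal A,\mu)\to(\mathcal B,\nu)$; $\nu(S(a),\sigma)-\nu(\sigma,T(a))$ for each 2-cell $\sigma:S\Rightarrow T$ ($S,T$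 the deformed composites of its source and target paths); and (pasting composite of the source) minus (pasting composite of the target) for each 3-cell $\gamma$. *)

(* Defs.v *)
From HB Require Import structures.
From mathcomp Require Import all_boot all_algebra.

Set Implicit Arguments.
Unset Strict Implicit.
Unset Printing Implicit Defensive.

Import GRing.Theory.
Local Open Scope ring_scope.

(** * Linear categories, functors, natural transformations

    Composition is written in diagrammatic order throughout: [kcomp f g] is
    "first [f], then [g]", and [fcomp F G] is the functor written G(F). *)

Record klcat (k : comPzRingType) := KLCat {
  ob :> Type;
  mor : ob -> ob -> lmodType k;
  idm : forall x, mor x x;
  kcomp : forall x y z, mor x y -> mor y z -> mor x z;
  comp_linl : forall x y z (g : mor y z), linear (fun f : mor x y => kcomp f g);
  comp_linr : forall x y z (f : mor x y), linear (fun g : mor y z => kcomp f g);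
  compA : forall x y z w (f : mor x y) (g : mor y z) (h : mor z w),
    kcomp (kcomp f g) h = kcomp f (kcomp g h);
  comp1l : forall x y (f : mor x y), kcomp (idm x) f = f;
  comp1r : forall x y (f : mor x y), kcomp f (idm y) = f }.

Arguments mor {k} A x y : rename.
Arguments idm {k A} x : rename.
Arguments kcomp {k A x y z} f g : rename.

Record klfun (k : comPzRingType) (A B : klcat k) := KLFun {
  fob :> A -> B;
  fmap : forall x y, mor A x y -> mor B (fob x) (fob y);
  fmap_lin : forall x y, linear (@fmap x y);
  fmap_comp : forall x y z (f : mor A x y) (g : mor A y z),
    fmap (kcomp f g) = kcomp (fmap f) (fmap g);
  fmap_id : forall x, fmap (idm x) = idm (fob x) }.

Arguments fob {k A B} F x : rename.
Arguments fmap {k A B} F {x y} f : rename.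

Section FunctorComposition.
Variable k : comPzRingType.

Definition fid (A : klcat k) : klfun A A :=
  @KLFun k A A (fun x => x) (fun x y f => f)
    (fun x y a f g => erefl) (fun x y z f g => erefl) (fun x => erefl).

Variables (A B C : klcat k) (F : klfun A B) (G : klfun B C).

Fact fcomp_lin (x y : A) : linear (fun f : mor A x y => fmap G (fmap F f)).
Proof. by move=> a f g; rewrite fmap_lin fmap_lin. Qed.

Fact fcomp_comp (x y z : A) (f : mor A x y) (g : mor A y z) :
  fmap G (fmap F (kcomp f g)) = kcomp (fmap G (fmap F f)) (fmap G (fmap F g)).
Proof. by rewrite !fmap_comp. Qed.

Fact fcomp_id (x : A) : fmap G (fmap F (idm x)) = idm (G (F x)).
Proof. by rewrite !fmap_id. Qed.

Definition fcomp : klfun A C :=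
  @KLFun k A C (fun x => G (F x)) (fun x y f => fmap G (fmap F f))
    fcomp_lin fcomp_comp fcomp_id.

End FunctorComposition.

Record nattrans (k : comPzRingType) (A B : klcat k) (F G : klfun A B) :=
  NatTrans {
    ncompo :> forall x : A, mor B (F x) (G x);
    ncompo_nat : forall x y (f : mor A x y),
      kcomp (fmap F f) (ncompo y) = kcomp (ncompo x) (fmap G f) }.

(** * Composable strings of arrows

    [str A n x y] is the type of composable strings of [n] arrows from [x] to
    [y].  It is defined by recursion on [n], a string of length 0 being a
    proof that its two ends coincide. *)

Section Strings.
Variables (k : comPzRingType) (A : klcat k).

Fixpoint str (n : nat) (x y : A) : Type :=
  match n with
  | 0 => x = y
  | n'.+1 => {z : A & (mor A x z * str n' z y)%type}
  end.

Definition snil (x : A) : str 0 x x := erefl.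

Definition scons n x z y (f : mor A x z) (s : str n z y) : str n.+1 x y :=
  existT _ z (f, s).

(* (f_0, ..., f_n) |-> ((f_0, ..., f_(n-1)), f_n) *)
Fixpoint unsnoc n x y :
    str n.+1 x y -> {z : A & (str n x z * mor A z y)%type} :=
  match n return str n.+1 x y -> {z : A & (str n x z * mor A z y)%type} with
  | 0 => fun s => let: existT z (f, e) := s in
      match e in _ = w return {z : A & (str 0 x z * mor A z w)%type} with
      | erefl => existT _ x (snil x, f)
      end
  | n'.+1 => fun s => let: existT z (f, t) := s in
      let: existT w (t', g) := unsnoc t in existT _ w (scons f t', g)
  end.

(* (f_0, ..., f_(n+1)) |-> (f_0, ..., f_i f_(i+1), ..., f_(n+1)), for
   i <= n; the value for i > n is never used. *)
Fixpoint smerge n (i : nat) x y : str n.+2 x y -> str n.+1 x y :=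
  match n return str n.+2 x y -> str n.+1 x y with
  | 0 => fun s => let: existT _ (f, existT _ (g, t)) := s in
      @scons 0 _ _ _ (kcomp f g) t
  | n'.+1 => fun s =>
      match i with
      | 0 => let: existT _ (f, existT _ (g, t)) := s in
          @scons n'.+1 _ _ _ (kcomp f g) t
      | i'.+1 => let: existT _ (f, t) := s in
          @scons n'.+1 _ _ _ f (@smerge n' i' _ _ t)
      end
  end.

(* k-multilinearity, in each arrow, of a map on strings starting at x *)
Fixpoint multilinear n (x : A) (T : A -> lmodType k) :
    (forall y, str n x y -> T y) -> Prop :=
  match n return (forall y, str n x y -> T y) -> Prop with
  | 0 => fun _ => True
  | n'.+1 => fun phi =>
      (forall z y (s : str n' z y),
         linear (fun f : mor A x z => phi y (scons f s))) /\
      (forall z (f : mor A x z),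
         multilinear (fun y (s : str n' z y) => phi y (scons f s)))
  end.

End Strings.

Arguments snil {k A} x.
Arguments scons {k A n x z y} f s.

Section StringsMap.
Variables (k : comPzRingType) (A B : klcat k).

Fixpoint smap (F : klfun A B) n x y : str n x y -> str n (F x) (F y) :=
  match n return str n x y -> str n (F x) (F y) with
  | 0 => fun e => match e in _ = w return F x = F w with erefl => erefl end
  | n'.+1 => fun s => let: existT _ (f, t) := s in
      scons (fmap F f) (smap F t)
  end.

(* (f_1, ..., f_n) |-> (F f_1, ..., F f_i, sigma, G f_(i+1), ..., G f_n), for
   i <= n; the value for i > n is never used. *)
Fixpoint sins (F G : klfun A B) (sigma : forall x, mor B (F x) (G x))
    n (i : nat) x y : str n x y -> str n.+1 (F x) (G y) :=
  match n, i return str n x y -> str n.+1 (F x) (G y) with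
  | n'.+1, i'.+1 => fun s => let: existT _ (f, t) := s in
      scons (fmap F f) (sins sigma i' t)
  | _, _ => fun s => scons (sigma x) (smap G s)
  end.

(* (f_1, ..., f_n) |-> (F f_1, ..., F f_i, sigma, G f_(i+1), ..., G f_j, tau,
   H f_(j+1), ..., H f_n), for i <= j <= n; other values are never used. *)
Fixpoint sins2 (F G H : klfun A B) (sigma : forall x, mor B (F x) (G x))
    (tau : forall x, mor B (G x) (H x))
    n (i j : nat) x y : str n x y -> str n.+2 (F x) (H y) :=
  match n, i return str n x y -> str n.+2 (F x) (H y) with
  | n'.+1, i'.+1 => fun s => let: existT _ (f, t) := s in
      scons (fmap F f) (sins2 sigma tau i' j.-1 t)
  | _, _ => fun s => scons (sigma x) (sins tau j s)
  end.

End StringsMap.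

(** * Hochschild cochains

    [cochain n F G] is the type of all families of maps on strings;
    C^n(F, G) is its submodule cut out by [multicochain]. *)

Definition cochain (k : comPzRingType) (A B : klcat k) (n : nat)
    (F G : klfun A B) : Type :=
  forall x y : A, str n x y -> mor B (F x) (G y).

Definition multicochain (k : comPzRingType) (A B : klcat k) n
    (F G : klfun A B) (phi : cochain n F G) : Prop :=
  forall x,
    multilinear (fun y (s : str n x y) => phi x y s : mor B (F x) (G y)).

Section Cochains.
Variable k : comPzRingType.

Section Differential.
Variables (A B : klcat k) (F G : klfun A B).

(* The terms in which two consecutive arrows are composed; there are none in
   degree 0, and i stands for i + 1 in the usual formula. *)
Definition dinner n : cochain n F G -> cochain n.+1 F G :=
  match n return cochain n F G -> cochain n.+1 F G with
  | 0 => fun _ _ _ _ => 0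
  | n'.+1 => fun phi x y s =>
      \sum_(i < n'.+1) (-1) ^+ i.+1 *: phi x y (smerge i s)
  end.

Definition dC n (phi : cochain n F G) : cochain n.+1 F G := fun x y s =>
  (let: existT _ (f, t) := s in kcomp (fmap F f) (phi _ _ t))
  + dinner phi s
  + (-1) ^+ n.+1 *:
      (let: existT _ (t, g) := unsnoc s in kcomp (phi _ _ t) (fmap G g)).

End Differential.

(* H_* and F^* *)
Definition push (A B C : klcat k) n (F G : klfun A B) (H : klfun B C)
    (phi : cochain n F G) : cochain n (fcomp F H) (fcomp G H) :=
  fun x y s => fmap H (phi x y s).

Definition pull (A B C : klcat k) n (F : klfun A B) (G H : klfun B C)
    (phi : cochain n G H) : cochain n (fcomp F G) (fcomp F H) :=
  fun x y s => phi _ _ (smap F s).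

(* tau_* and tau^* *)
Definition npush (A B : klcat k) n (G F1 F2 : klfun A B)
    (tau : forall x, mor B (F1 x) (F2 x)) (phi : cochain n G F1) :
    cochain n G F2 :=
  fun x y s => kcomp (phi x y s) (tau y).

Definition npull (A B : klcat k) n (F1 F2 G : klfun A B)
    (tau : forall x, mor B (F1 x) (F2 x)) (phi : cochain n F2 G) :
    cochain n F1 G :=
  fun x y s => kcomp (tau x) (phi x y s).

(* nu{sigma} and nu{sigma, tau}; the case nu in C(B) is K := fid B. *)
Definition brace1 (A B C : klcat k) n (F G : klfun A B) (K : klfun B C)
    (nu : cochain n.+1 K K) (sigma : forall x, mor B (F x) (G x)) :
    cochain n (fcomp F K) (fcomp G K) :=
  fun x y s => - \sum_(i < n.+1) (-1) ^+ i *: nu _ _ (sins sigma i s).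

Definition brace2 (A B C : klcat k) n (F G H : klfun A B) (K : klfun B C)
    (nu : cochain n.+2 K K) (sigma : forall x, mor B (F x) (G x))
    (tau : forall x, mor B (G x) (H x)) :
    cochain n (fcomp F K) (fcomp H K) :=
  fun x y s => - \sum_(i < n.+1) \sum_(j < n.+1 | (i <= j)%N)
    (-1) ^+ (i + j) *: nu _ _ (sins2 sigma tau i j s).

End Cochains.

Arguments multicochain {k A B n F G} phi.

(** * Shapes of pasting diagrams

    A composable path, resp. a composable 2-dimensional pasting diagram, is
    given together with a way of building it from its cells: a [cpath] carries a
    bracketing (composition of functors being strictly associative, its
    composite does not depend on it), and a [pasting] is built from 2-cells by
    vertical composition, precomposition and postcomposition.  Parallel paths
    are compared with their bracketings. *)

Record quiver := Quiver {
  cell0 : Type;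
  cell1 : Type;
  src1 : cell1 -> cell0;
  tgt1 : cell1 -> cell0 }.

Inductive cpath (Q : quiver) : cell0 Q -> cell0 Q -> Type :=
  | Edge (f : cell1 Q) : cpath (src1 f) (tgt1 f)
  | Concat a b c (p : cpath a b) (q : cpath b c) : cpath a c.

Record quiver2 := Quiver2 {
  quiver_of :> quiver;
  cell2 : Type;
  dom2 : cell2 -> cell0 quiver_of;
  cod2 : cell2 -> cell0 quiver_of;
  src2 : forall s : cell2, cpath (dom2 s) (cod2 s);
  tgt2 : forall s : cell2, cpath (dom2 s) (cod2 s) }.

Inductive pasting (Q : quiver2) :
    forall a b : cell0 Q, cpath a b -> cpath a b -> Type :=
  | Cell (s : cell2 Q) : pasting (src2 s) (tgt2 s)
  | Vert a b (S T U : cpath a b) (u : pasting S T) (v : pasting T U) :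
      pasting S U
  | Pre a b c (F : cpath a b) (S T : cpath b c) (u : pasting S T) :
      pasting (Concat F S) (Concat F T)
  | Post a b c (S T : cpath a b) (u : pasting S T) (H : cpath b c) :
      pasting (Concat S H) (Concat T H).

Fixpoint ncomps (Q : quiver2) (a b : cell0 Q) (S T : cpath a b)
    (u : pasting S T) : nat :=
  match u with
  | Cell _ => 0
  | Vert _ _ _ _ _ u v => (ncomps u + ncomps v).+1
  | Pre _ _ _ _ _ _ u => (ncomps u).+1
  | Post _ _ _ _ _ u _ => (ncomps u).+1
  end.

Record quiver3 := Quiver3 {
  quiver2_of :> quiver2;
  cell3 : Type;
  dom3 : cell3 -> cell0 quiver2_of;
  cod3 : cell3 -> cell0 quiver2_of;
  bsrc3 : forall g : cell3, cpath (dom3 g) (cod3 g);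
  btgt3 : forall g : cell3, cpath (dom3 g) (cod3 g);
  src3 : forall g : cell3, pasting (bsrc3 g) (btgt3 g);
  tgt3 : forall g : cell3, pasting (bsrc3 g) (btgt3 g) }.

(** * Pasting diagrams *)

Section Labels.
Variables (k : comPzRingType).

Section PathComposite.
Variables (Q : quiver) (cat : cell0 Q -> klcat k).
Variable fn : forall f : cell1 Q, klfun (cat (src1 f)) (cat (tgt1 f)).

Fixpoint pfun (a b : cell0 Q) (p : cpath a b) : klfun (cat a) (cat b) :=
  match p in cpath a b return klfun (cat a) (cat b) with
  | Edge f => fn f
  | Concat _ _ _ p q => fcomp (pfun p) (pfun q)
  end.

End PathComposite.

Section PastingComposite.
Variables (Q : quiver2) (cat : cell0 Q -> klcat k).
Variable fn : forall f : cell1 Q, klfun (cat (src1 f)) (cat (tgt1 f)).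
Variable nt : forall s : cell2 Q,
  nattrans (pfun fn (src2 s)) (pfun fn (tgt2 s)).

Fixpoint pnat (a b : cell0 Q) (S T : cpath a b) (u : pasting S T) :
    forall x : cat a, mor (cat b) (pfun fn S x) (pfun fn T x) :=
  match u in @pasting _ a b S T
    return forall x : cat a, mor (cat b) (pfun fn S x) (pfun fn T x) with
  | Cell s => nt s
  | Vert _ _ _ _ _ u v => fun x => kcomp (pnat u x) (pnat v x)
  | Pre _ _ _ F _ _ u => fun x => pnat u (pfun fn F x)
  | Post _ _ _ _ _ u H => fun x => fmap (pfun fn H) (pnat u x)
  end.

End PastingComposite.
End Labels.

Record pasting_diagram (k : comPzRingType) := PastingDiagram {
  dshape :> quiver3;
  dcat : cell0 dshape -> klcat k;
  dfun : forall f : cell1 dshape, klfun (dcat (src1 f)) (dcat (tgt1 f));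
  dnat : forall s : cell2 dshape,
    nattrans (pfun dfun (src2 s)) (pfun dfun (tgt2 s));
  dcomm : forall (g : cell3 dshape) (x : dcat (dom3 g)),
    pnat dnat (src3 g) x = pnat dnat (tgt3 g) x }.

(* Exactly one composition involving a natural transformation occurs among the
   sources and targets of all 3-cells. *)
Definition single_composition (k : comPzRingType) (D : pasting_diagram k) :
    Prop :=
  exists g0 : cell3 D,
    (ncomps (src3 g0) + ncomps (tgt3 g0) = 1)%N /\
    forall g : cell3 D, g <> g0 ->
      (ncomps (src3 g) + ncomps (tgt3 g) = 0)%N.

(** * The deformation complex *)

Section DeformationComplex.
Variables (k : comPzRingType) (D : pasting_diagram k).

Local Notation cat := (@dcat k D).
Local Notation "[ p ]" := (pfun (@dfun k D) p).
Local Notation ev := (pnat (@dnat k D)).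

(* Families of cochains indexed by the cells, in total degree p >= 0.  For a
   finite D they form the direct sum of the summands; no finiteness is needed
   below, since every coordinate of the differential involves finitely many
   coordinates of its argument. *)
Record chain (p : nat) := Chain {
  ch0 : forall a : cell0 D, cochain p.+3 (fid (cat a)) (fid (cat a));
  ch1 : forall f : cell1 D, cochain p.+2 (dfun f) (dfun f);
  ch2 : forall s : cell2 D, cochain p.+1 [src2 s] [tgt2 s];
  ch3 : forall g : cell3 D, cochain p [bsrc3 g] [btgt3 g] }.

Arguments ch0 {p} c a [x y] t : rename.
Arguments ch1 {p} c f [x y] t : rename.
Arguments ch2 {p} c s [x y] t : rename.
Arguments ch3 {p} c g [x y] t : rename.

Definition in_complex p (x : chain p) : Prop :=
  [/\ forall a, multicochain (ch0 x a), forall f, multicochain (ch1 x f),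
      forall s, multicochain (ch2 x s) & forall g, multicochain (ch3 x g)].

Definition is_zero p (x : chain p) : Prop :=
  [/\ forall a y z (t : str p.+3 y z), ch0 x a t = 0,
      forall f y z (t : str p.+2 y z), ch1 x f t = 0,
      forall s y z (t : str p.+1 y z), ch2 x s t = 0
    & forall g y z (t : str p y z), ch3 x g t = 0].

(* The maps wp, on paths and on 2-dimensional pasting diagrams *)
Fixpoint wp1 p (x : chain p) (a b : cell0 D) (q : cpath a b) :
    cochain p.+2 [q] [q] :=
  match q in cpath a b return cochain p.+2 [q] [q] with
  | Edge f => ch1 x f
  | Concat _ _ _ q r => fun y z t =>
      push [r] (wp1 x q) t + pull [q] (wp1 x r) t
  end.

Fixpoint wp2 p (x : chain p) (a b : cell0 D) (S T : cpath a b)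
    (u : pasting S T) : cochain p.+1 [S] [T] :=
  match u in @pasting _ a b S T return cochain p.+1 [S] [T] with
  | Cell s => ch2 x s
  | Vert _ b _ _ _ u v => fun y z t =>
      npush (ev v) (wp2 x u) t + npull (ev u) (wp2 x v) t
      + brace2 (ch0 x b) (ev u) (ev v) t
  | Pre _ _ _ F _ _ u => pull [F] (wp2 x u)
  | Post _ _ _ _ _ u H => fun y z t =>
      push [H] (wp2 x u) t + brace1 (wp1 x H) (ev u) t
  end.

Definition dD p (x : chain p) : chain p.+1 := {|
  ch0 := fun a y z t => - dC (ch0 x a) t;
  ch1 := fun f y z t =>
    - push (dfun f) (ch0 x (src1 f)) t + pull (dfun f) (ch0 x (tgt1 f)) t
    + dC (ch1 x f) t;
  ch2 := fun s y z t =>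
    brace1 (ch0 x (cod2 s)) (dnat s) t
    + npush (dnat s) (wp1 x (src2 s)) t - npull (dnat s) (wp1 x (tgt2 s)) t
    - dC (ch2 x s) t;
  ch3 := fun g y z t =>
    wp2 x (src3 g) t - wp2 x (tgt3 g) t + dC (ch3 x g) t |}.

Definition cocycle p (x : chain p) : Prop :=
  in_complex x /\ is_zero (dD x).

End DeformationComplex.

(** * Deformations

    A power series in the deformation parameter with coefficients in [V] is a
    sequence [nat -> V]; modulo epsilon^(n+1) only the coefficients of index at
    most [n] matter. *)

Section Series.
Variable k : comPzRingType.

Definition sconst (V : lmodType k) (v : V) : nat -> V :=
  fun m => if m is 0 then v else 0.

(* The value of sum_i F_i epsilon^i at a series, F_i linear *)
Definition sapp (V W : lmodType k) (F : nat -> V -> W) (v : nat -> V) :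
    nat -> W :=
  fun m => \sum_(i < m.+1) \sum_(j < m.+1 | (i + j == m)%N) F i (v j).

(* The value of sum_i mu_i epsilon^i at two series, mu_i bilinear *)
Definition sapp2 (U V W : lmodType k) (mu : nat -> U -> V -> W)
    (u : nat -> U) (v : nat -> V) : nat -> W :=
  fun m => \sum_(i < m.+1) \sum_(j < m.+1)
    \sum_(l < m.+1 | (i + j + l == m)%N) mu i (u j) (v l).

End Series.

Section Deformations.
Variables (k : comPzRingType) (D : pasting_diagram k).

Local Notation cat := (@dcat k D).
Local Notation "[ p ]" := (pfun (@dfun k D) p).

Record coefficients := Coefficients {
  cmu : forall (a : cell0 D) (i : nat) (x y z : cat a),
    mor (cat a) x y -> mor (cat a) y z -> mor (cat a) x z;
  cfun : forall (f : cell1 D) (i : nat) (x y : cat (src1 f)),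
    mor (cat (src1 f)) x y -> mor (cat (tgt1 f)) (dfun f x) (dfun f y);
  cnat : forall (s : cell2 D) (i : nat) (x : cat (dom2 s)),
    mor (cat (cod2 s)) ([src2 s] x) ([tgt2 s] x) }.

Arguments cmu c a i {x y z} f g : rename.
Arguments cfun c f i {x y} _ : rename.
Arguments cnat c s i x : clear implicits.

Section Composites.
Variable c : coefficients.

Definition smu (a : cell0 D) (x y z : cat a) (u : nat -> mor (cat a) x y)
    (v : nat -> mor (cat a) y z) : nat -> mor (cat a) x z :=
  sapp2 (fun i => @cmu c a i x y z) u v.

Fixpoint spath (a b : cell0 D) (p : cpath a b) (x y : cat a)
    (u : nat -> mor (cat a) x y) {struct p} :
    nat -> mor (cat b) ([p] x) ([p] y) :=
  match p in cpath a b return forall x y : cat a, (nat -> mor (cat a) x y) ->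
    nat -> mor (cat b) ([p] x) ([p] y) with
  | Edge f => fun x y u => sapp (fun i => @cfun c f i x y) u
  | Concat _ _ _ p q => fun x y u => spath q (spath p u)
  end x y u.

Fixpoint spasting (a b : cell0 D) (S T : cpath a b) (u : pasting S T) :
    forall x : cat a, nat -> mor (cat b) ([S] x) ([T] x) :=
  match u in @pasting _ a b S T
    return forall x : cat a, nat -> mor (cat b) ([S] x) ([T] x) with
  | Cell s => fun x i => cnat c s i x
  | Vert _ _ _ _ _ u v => fun x => smu (spasting u x) (spasting v x)
  | Pre _ _ _ F _ _ u => fun x => spasting u ([F] x)
  | Post _ _ _ _ _ u H => fun x => spath H (spasting u x)
  end.

(* Coefficients of epsilon^m of the failures of associativity, functoriality,
   naturality and of the equalities asserted by the 3-cells *)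

Definition Rcat (m : nat) (a : cell0 D) (x y z w : cat a)
    (f : mor (cat a) x y) (g : mor (cat a) y z) (h : mor (cat a) z w) :
    mor (cat a) x w :=
  smu (smu (sconst f) (sconst g)) (sconst h) m
  - smu (sconst f) (smu (sconst g) (sconst h)) m.

Definition Rfun (m : nat) (F : cell1 D) (x y z : cat (src1 F))
    (f : mor (cat (src1 F)) x y) (g : mor (cat (src1 F)) y z) :
    mor (cat (tgt1 F)) (dfun F x) (dfun F z) :=
  spath (Edge F) (smu (sconst f) (sconst g)) m
  - smu (spath (Edge F) (sconst f)) (spath (Edge F) (sconst g)) m.

Definition Rnat (m : nat) (s : cell2 D) (x y : cat (dom2 s))
    (f : mor (cat (dom2 s)) x y) :
    mor (cat (cod2 s)) ([src2 s] x) ([tgt2 s] y) :=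
  smu (spath (src2 s) (sconst f)) (fun i => cnat c s i y) m
  - smu (fun i => cnat c s i x) (spath (tgt2 s) (sconst f)) m.

Definition Rcell3 (m : nat) (g : cell3 D) (x : cat (dom3 g)) :
    mor (cat (cod3 g)) ([bsrc3 g] x) ([btgt3 g] x) :=
  spasting (src3 g) x m - spasting (tgt3 g) x m.

End Composites.

Arguments Rcell3 c m g x : clear implicits.

(* Coefficients of index > n do not exist over k[epsilon]/(epsilon^(n+1)):
   they are recorded as 0, so that every coefficient of epsilon^(n+1) formed
   from an order n deformation has the terms of degree n+1 set to 0. *)
Record deformation (n : nat) := Deformation {
  coefs :> coefficients;
  cmu_linl : forall a i x y z (g : mor (cat a) y z),
    linear (fun f : mor (cat a) x y => cmu coefs a i f g);
  cmu_linr : forall a i x y z (f : mor (cat a) x y),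
    linear (fun g : mor (cat a) y z => cmu coefs a i f g);
  cfun_lin : forall f i x y, linear (@cfun coefs f i x y);
  cmu0 : forall a x y z (f : mor (cat a) x y) (g : mor (cat a) y z),
    cmu coefs a 0 f g = kcomp f g;
  cfun0 : forall F x y (f : mor (cat (src1 F)) x y),
    cfun coefs F 0 f = fmap (dfun F) f;
  cnat0 : forall s x, cnat coefs s 0 x = dnat s x;
  cmu_trunc : forall a i x y z (f : mor (cat a) x y) (g : mor (cat a) y z),
    (n < i)%N -> cmu coefs a i f g = 0;
  cfun_trunc : forall F i x y (f : mor (cat (src1 F)) x y),
    (n < i)%N -> cfun coefs F i f = 0;
  cnat_trunc : forall s i x, (n < i)%N -> cnat coefs s i x = 0;
  def_assoc : forall m a x y z w (f : mor (cat a) x y) (g : mor (cat a) y z)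
    (h : mor (cat a) z w), (m <= n)%N -> Rcat coefs m f g h = 0;
  def_functorial : forall m F x y z (f : mor (cat (src1 F)) x y)
    (g : mor (cat (src1 F)) y z), (m <= n)%N -> Rfun coefs m f g = 0;
  def_natural : forall m s x y (f : mor (cat (dom2 s)) x y),
    (m <= n)%N -> Rnat coefs m f = 0;
  def_comm : forall m g x, (m <= n)%N -> Rcell3 coefs m g x = 0 }.

(* The obstruction to extending an order n deformation to order n+1; the
   arrows of a string are bound in order, and the last component e identifies
   the end of the string. *)
Definition obstruction n (c : deformation n) : chain D 0 := {|
  ch0 := fun a x y (t : str 3 x y) =>
    let: existT _ (f, existT _ (g, existT w (h, e))) := t in
    match e in _ = y return mor (cat a) x y with
    | erefl => - Rcat c n.+1 f g h
    end;
  ch1 := fun F x y (t : str 2 x y) =>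
    let: existT _ (f, existT w (g, e)) := t in
    match e in _ = y return mor (cat (tgt1 F)) (dfun F x) (dfun F y) with
    | erefl => Rfun c n.+1 f g
    end;
  ch2 := fun s x y (t : str 1 x y) =>
    let: existT w (f, e) := t in
    match e in _ = y return mor (cat (cod2 s)) ([src2 s] x) ([tgt2 s] y) with
    | erefl => - Rnat c n.+1 f
    end;
  ch3 := fun g x y (e : str 0 x y) =>
    match e in _ = y return mor (cat (cod3 g)) ([bsrc3 g] x) ([btgt3 g] y) with
    | erefl => Rcell3 c n.+1 g x
    end |}.

End Deformations.

(* Main.v *)
(* The failures of associativity, functoriality, naturality and of the 3-cell
   equations, computed over k[[epsilon]], satisfy identities (the pentagon and
   its analogues) that hold exactly, since they are formal consequences of
   multilinearity: each term cancels against another.  For a deformation of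
   order n these failures vanish in orders at most n, so the coefficient of
   epsilon^(n+1) in such an identity involves only the undeformed structure and
   the obstruction, and it is the cocycle equation.  The maps wp compute the
   coefficient of epsilon^(n+1) in the failures attached to composite paths and
   pasting composites, by the same mechanism. *)

Require Import Defs.
From mathcomp Require Import all_boot all_algebra.
From mathcomp Require Import ssrAC.

Set Implicit Arguments.
Unset Strict Implicit.
Unset Printing Implicit Defensive.

Import GRing.Theory.
Local Open Scope ring_scope.

(** * Operators on power series that are linear over k[[epsilon]] *)

Section SeriesOperators.
Variable k : comPzRingType.

(* k[[epsilon]]-linearity: the second clause is compatibility with
   multiplication by epsilon, where w = epsilon u. *)
Definition eps_linear (V W : lmodType k) (T : (nat -> V) -> nat -> W) : Prop :=
  (forall a u v w, (forall i, w i = a *: u i + v i) ->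
     forall m, T w m = a *: T u m + T v m) /\
  (forall u w, w 0%N = 0 -> (forall i, w i.+1 = u i) ->
     T w 0%N = 0 /\ forall m, T w m.+1 = T u m).

Section Theory.
Variables (V W : lmodType k) (T : (nat -> V) -> nat -> W).
Hypothesis linT : eps_linear T.

Lemma eps_linearD u v w :
  (forall i, w i = u i + v i) -> forall m, T w m = T u m + T v m.
Proof.
by move=> e m; rewrite (linT.1 1 u v w) ?scale1r // => i; rewrite scale1r.
Qed.

Lemma eps_linearB u v w :
  (forall i, w i = u i - v i) -> forall m, T w m = T u m - T v m.
Proof.
move=> e m; rewrite (linT.1 (-1) v u w) ?scaleN1r 1?addrC // => i.
by rewrite scaleN1r addrC.
Qed.

Lemma eps_linear_sconst m : linear (fun x => T (sconst x) m).
Proof.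
move=> a x y; apply: linT.1 => -[|i] //=.
by rewrite scaler0 addr0.
Qed.

(** A series is its constant term plus epsilon times its shift, and [T] commutes with multiplication
    by epsilon. *)
Lemma eps_linear_split u :
  T u 0%N = T (sconst (u 0%N)) 0%N /\
  forall m, T u m.+1 = T (sconst (u 0%N)) m.+1 + T (u \o succn) m.
Proof.
pose w i := if i is i'.+1 then u i'.+1 else 0.
have e i : u i = sconst (u 0%N) i + w i.
  by case: i => [|i] /=; rewrite ?addr0 ?add0r.
have [w0 wS] := linT.2 (u \o succn) w erefl (fun=> erefl).
by split=> [|m]; rewrite (eps_linearD e) ?w0 ?wS ?addr0.
Qed.

(** Divisibility by epsilon^N is preserved, and the leading coefficient is transformed by the order
    0 part of [T] alone. The induction divides out one epsilon at a time. *)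
Lemma eps_linear_order N u : (forall i, (i < N)%N -> u i = 0) ->
  (forall i, (i < N)%N -> T u i = 0) /\ T u N = T (sconst (u N)) 0%N.
Proof.
elim: N u => [|N IHN] u u0; first by split=> //; case: (eps_linear_split u).
have [Tu0 TuS] := linT.2 (u \o succn) u (u0 0%N isT) (fun=> erefl).
have [i|IH IHe] := IHN (u \o succn); first exact: u0 i.+1.
by split=> [[|i] iN|] //; rewrite TuS // IH.
Qed.

(** This transfers the axioms of a deformation, which are stated for constant arrows, to arbitrary
    series. Where [T] kills constants in orders below [N], the part of [u] divisible by epsilon
    contributes only beyond order [N], so coefficient [N] sees the constant term alone. *)
Lemma eps_linear_vanish N u :
  (forall x i, (i < N)%N -> T (sconst x) i = 0) ->
  (forall i, (i < N)%N -> T u i = 0) /\ T u N = T (sconst (u 0%N)) N.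
Proof.
move=> T0; have vT i v : (i < N)%N -> T v i = 0.
  elim: i v => [|i IHi] v iN; have [e eS] := eps_linear_split v.
    by rewrite e T0.
  by rewrite eS T0 // IHi ?addr0 // ltnW.
split=> [i|]; first exact: vT.
have [e eS] := eps_linear_split u.
by case: N T0 vT e eS => [|N] T0 vT e eS //; rewrite eS (vT N) ?addr0.
Qed.

End Theory.

Lemma eps_linear_comp (U V W : lmodType k) (S : (nat -> U) -> nat -> V)
    (T : (nat -> V) -> nat -> W) :
  eps_linear S -> eps_linear T -> eps_linear (fun u => T (S u)).
Proof.
move=> linS linT; split=> [a u v w e m|u w w0 wS].
  by apply: linT.1 => i; apply: linS.1.
by have [S0 SS] := linS.2 u w w0 wS; apply: linT.2.
Qed.

Lemma eps_linear_sub (V W : lmodType k) (S T : (nat -> V) -> nat -> W) :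
  eps_linear S -> eps_linear T -> eps_linear (fun u m => S u m - T u m).
Proof.
move=> linS linT; split=> [a u v w e m|u w w0 wS].
  by rewrite (linS.1 a u v w e) (linT.1 a u v w e) scalerBr opprD addrACA.
have [S0 SS] := linS.2 u w w0 wS; have [T0 TS] := linT.2 u w w0 wS.
by split=> [|m]; rewrite ?S0 ?T0 ?subrr // SS TS.
Qed.

Lemma linear_fun0 (V W : lmodType k) (F : V -> W) : linear F -> F 0 = 0.
Proof.
by move=> linF; have := linF (-1) 0 0; rewrite scaler0 addr0 scaleN1r addNr.
Qed.

Lemma linear_funN (V W : lmodType k) (F : V -> W) x :
  linear F -> F (- x) = - F x.
Proof.
move=> linF; have := linF (-1) x 0.
by rewrite (linear_fun0 linF) !addr0 !scaleN1r.
Qed.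

Lemma linear_opp (V W : lmodType k) (F : V -> W) :
  linear F -> linear (fun x => - F x).
Proof. by move=> linF a x y; rewrite linF opprD scalerN. Qed.

Lemma sapp_eps_linear (V W : lmodType k) (F : nat -> V -> W) :
  (forall i, linear (F i)) -> eps_linear (sapp F).
Proof.
move=> linF; have F0 i : F i 0 = 0 by apply: linear_fun0.
split=> [a u v w e m|u w w0 wS].
  rewrite /sapp scaler_sumr -big_split; apply: eq_bigr => i _ /=.
  rewrite scaler_sumr -big_split; apply: eq_bigr => j _ /=.
  by rewrite e linF.
split=> [|m].
  rewrite /sapp big1 // => i _; rewrite big1 // => j _.
  by rewrite (ord1 j) w0 F0.
(* The index [i = m+1] forces [j = 0], where [w] vanishes. In the other summands the term [j = 0]
   vanishes too, and the rest is reindexed by [j+1]. *)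
rewrite /sapp big_ord_recr /= [X in _ + X]big1 ?addr0 => [|j]; last first.
  by case: j => -[|j] jm /=; rewrite ?w0 ?F0 // -[X in _ == X]addn0 eqn_add2l.
apply: eq_bigr => i _; rewrite big_mkcond big_ord_recl /= w0 F0 if_same add0r.
rewrite [RHS]big_mkcond; apply: eq_bigr => j _.
by rewrite /bump /= add1n addnS eqSS wS.
Qed.

Lemma sapp2l_eps_linear (U V W : lmodType k) (mu : nat -> U -> V -> W) v :
  (forall i y, linear (mu i ^~ y)) -> eps_linear (fun u => sapp2 mu u v).
Proof.
move=> linmu; have mu0 i y : mu i 0 y = 0 by apply: linear_fun0 (linmu i y).
split=> [a u u' w e m|u w w0 wS].
  rewrite /sapp2 scaler_sumr -big_split; apply: eq_bigr => i _ /=.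
  rewrite scaler_sumr -big_split; apply: eq_bigr => j _ /=.
  rewrite scaler_sumr -big_split; apply: eq_bigr => l _ /=.
  by rewrite e linmu.
split=> [|m].
  rewrite /sapp2 big1 // => i _; rewrite big1 // => j _.
  by rewrite big1 // => l _; rewrite (ord1 j) w0 mu0.
(* Three boundary cases disappear: [i = m+1] leaves only [j = 0], the terms with [j = 0] vanish with
   [w 0], and once [j >= 1] the value [l = m+1] is out of range. *)
rewrite /sapp2 big_ord_recr /= [X in _ + X]big1 ?addr0 => [|[[|j] jm] _];
  last first.
- by rewrite big_pred0 // => l; rewrite -addnA -[X in _ == X]addn0 eqn_add2l.
- by rewrite big1 // => l _; rewrite w0 mu0.
apply: eq_bigr => i _; rewrite big_ord_recl /=.
rewrite [X in X + _]big1 ?add0r => [|l _]; last first.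
  by rewrite w0 mu0.
apply: eq_bigr => j _; rewrite big_mkcond big_ord_recr /=.
have ijm : (i + j + m.+1 == m)%N = false.
  by rewrite addnS -addSn -[X in _ == X]add0n eqn_add2r.
rewrite /bump /= add1n addnS addSn eqSS ijm addr0.
rewrite [RHS]big_mkcond; apply: eq_bigr => l _.
by rewrite addSn eqSS wS.
Qed.

(** Exchanging the two inner sums reduces linearity in the second argument to linearity in the
    first. *)
Lemma sapp2C (U V W : lmodType k) (mu : nat -> U -> V -> W) u v :
  sapp2 mu u v =1 sapp2 (fun i y x => mu i x y) v u.
Proof.
move=> m; apply: eq_bigr => i _.
rewrite (exchange_big_dep predT) //=; apply: eq_bigr => l _.
by apply: eq_bigl => j; rewrite addnAC.
Qed.

Lemma sapp2r_eps_linear (U V W : lmodType k) (mu : nat -> U -> V -> W) u :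
  (forall i x, linear (mu i x)) -> eps_linear (sapp2 mu u).
Proof.
move=> linmu; have [lin sh] :=
  @sapp2l_eps_linear V U W (fun i y x => mu i x y) u (fun i x => linmu i x).
split=> [a v v' w e m|v w w0 wS].
  by rewrite (sapp2C mu u w) (sapp2C mu u v) (sapp2C mu u v'); apply: lin.
have [e eS] := sh v w w0 wS.
by split=> [|m]; rewrite (sapp2C mu u w) ?e // eS (sapp2C mu u v).
Qed.

Lemma sapp_coef0 (V W : lmodType k) (F : nat -> V -> W) u :
  sapp F u 0%N = F 0%N (u 0%N).
Proof. by rewrite /sapp big_ord1 big_mkcond big_ord1. Qed.

Lemma sapp2_coef0 (U V W : lmodType k) (mu : nat -> U -> V -> W) u v :
  sapp2 mu u v 0%N = mu 0%N (u 0%N) (v 0%N).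
Proof. by rewrite /sapp2 !big_ord1 big_mkcond big_ord1. Qed.

End SeriesOperators.

(** * Hochschild differential and braces written out in the low degrees that occur *)

Section LowDegreeCochains.
Variable k : comPzRingType.

Lemma kcompNl (A : klcat k) x y z (f : mor A x y) (g : mor A y z) :
  kcomp (- f) g = - kcomp f g.
Proof. by have := linear_funN f (comp_linl g). Qed.

Lemma kcompNr (A : klcat k) x y z (f : mor A x y) (g : mor A y z) :
  kcomp f (- g) = - kcomp f g.
Proof. by have := linear_funN g (comp_linr f). Qed.

Lemma fmapN (A B : klcat k) (F : klfun A B) x y (f : mor A x y) :
  fmap F (- f) = - fmap F f.
Proof. by have := linear_funN f (@fmap_lin k A B F x y). Qed.

Section Differential.
Variables (A B : klcat k) (F G : klfun A B).

Lemma dC0E (phi : cochain 0 F G) x y (f : mor A x y) :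
  dC phi (scons f (snil y))
  = kcomp (fmap F f) (phi _ _ (snil y)) - kcomp (phi _ _ (snil x)) (fmap G f).
Proof. by rewrite /dC /= addr0 expr1 scaleN1r. Qed.

Lemma dC1E (phi : cochain 1 F G) x y z (f : mor A x y) (g : mor A y z) :
  dC phi (scons f (scons g (snil z)))
  = kcomp (fmap F f) (phi _ _ (scons g (snil z)))
    - phi _ _ (scons (kcomp f g) (snil z))
    + kcomp (phi _ _ (scons f (snil y))) (fmap G g).
Proof. by rewrite /dC /= big_ord1 expr1 scaleN1r sqrrN expr1n scale1r. Qed.

Lemma dC2E (phi : cochain 2 F G) x y z w (f : mor A x y) (g : mor A y z)
    (h : mor A z w) :
  dC phi (scons f (scons g (scons h (snil w))))
  = kcomp (fmap F f) (phi _ _ (scons g (scons h (snil w))))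
    - phi _ _ (scons (kcomp f g) (scons h (snil w)))
    + phi _ _ (scons f (scons (kcomp g h) (snil w)))
    - kcomp (phi _ _ (scons f (scons g (snil z)))) (fmap G h).
Proof.
rewrite /dC /= big_ord_recl big_ord1 /= /bump /= expr1 !scaleN1r.
by rewrite sqrrN expr1n scale1r exprS sqrrN expr1n mulr1 scaleN1r addrA.
Qed.

Lemma dC3E (phi : cochain 3 F G) x y z w v (f : mor A x y) (g : mor A y z)
    (h : mor A z w) (l : mor A w v) :
  dC phi (scons f (scons g (scons h (scons l (snil v)))))
  = kcomp (fmap F f) (phi _ _ (scons g (scons h (scons l (snil v)))))
    - phi _ _ (scons (kcomp f g) (scons h (scons l (snil v))))
    + phi _ _ (scons f (scons (kcomp g h) (scons l (snil v))))
    - phi _ _ (scons f (scons g (scons (kcomp h l) (snil v))))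
    + kcomp (phi _ _ (scons f (scons g (scons h (snil w))))) (fmap G l).
Proof.
rewrite /dC /= !big_ord_recl big_ord0 addr0 /= /bump /= expr1 !scaleN1r.
have e2 : (-1) ^+ 2 = 1 :> k by rewrite sqrrN expr1n.
have e3 : (-1) ^+ 3 = -1 :> k by rewrite exprS e2 mulr1.
have e4 : (-1) ^+ 4 = 1 :> k by rewrite exprS e3 mulN1r opprK.
by rewrite e2 e3 e4 !scale1r scaleN1r !addrA.
Qed.

End Differential.

Section Braces.
Variables (A B C : klcat k) (F G H : klfun A B) (K : klfun B C).
Variables (sigma : forall x, mor B (F x) (G x)).
Variables (tau : forall x, mor B (G x) (H x)).

Lemma brace1_1E (nu : cochain 2 K K) x y (f : mor A x y) :
  brace1 nu sigma (scons f (snil y))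
  = nu _ _ (scons (fmap F f) (scons (sigma y) (snil (G y))))
    - nu _ _ (scons (sigma x) (scons (fmap G f) (snil (G y)))).
Proof.
rewrite /brace1 big_ord_recl big_ord1 /= /bump /= expr0 expr1 scale1r.
by rewrite scaleN1r opprB.
Qed.

Lemma brace1_2E (nu : cochain 3 K K) x y z (f : mor A x y) (g : mor A y z) :
  brace1 nu sigma (scons f (scons g (snil z)))
  = nu _ _ (scons (fmap F f) (scons (sigma y) (scons (fmap G g) (snil (G z)))))
    - nu _ _
        (scons (sigma x) (scons (fmap G f) (scons (fmap G g) (snil (G z)))))
    - nu _ _
        (scons (fmap F f) (scons (fmap F g) (scons (sigma z) (snil (G z))))).
Proof.
rewrite /brace1 !big_ord_recl big_ord0 addr0 /= /bump /= expr0 expr1 scale1r.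
by rewrite scaleN1r sqrrN expr1n scale1r !opprD opprK addrA [- _ + _]addrC.
Qed.

Lemma brace2_1E (nu : cochain 3 K K) x y (f : mor A x y) :
  brace2 nu sigma tau (scons f (snil y))
  = nu _ _ (scons (sigma x) (scons (fmap G f) (scons (tau y) (snil (H y)))))
    - nu _ _ (scons (sigma x) (scons (tau x) (scons (fmap H f) (snil (H y)))))
    - nu _ _ (scons (fmap F f) (scons (sigma y) (scons (tau y) (snil (H y))))).
Proof.
rewrite /brace2 big_ord_recl big_ord1.
(* The constraint [i <= j] leaves the pairs (0,0), (0,1) and (1,1), one for each term of the
   formula. *)
rewrite !(big_mkcond (fun j : 'I_2 => (_ <= j)%N)).
rewrite !big_ord_recl !big_ord0 /= /bump /= expr0 expr1 scale1r.
rewrite scaleN1r sqrrN expr1n scale1r !addr0 add0r.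
by rewrite opprD opprB.
Qed.

End Braces.

End LowDegreeCochains.

(** * Leading coefficients of the deformed operations *)

Section Obstruction.
Variables (k : comPzRingType) (D : pasting_diagram k).
Variables (n : nat) (c : deformation D n).

Local Notation cat := (@dcat k D).
Local Notation "[ p ]" := (pfun (@dfun k D) p).

Definition low_order (V : lmodType k) (u : nat -> V) : Prop :=
  forall i, (i < n.+1)%N -> u i = 0.

Section Composition.
Variables (a : cell0 D) (x y z : cat a).

Lemma smul_eps_linear (v : nat -> mor (cat a) y z) :
  eps_linear (fun u : nat -> mor (cat a) x y => smu c u v).
Proof. by apply: sapp2l_eps_linear => i g; apply: cmu_linl. Qed.

Lemma smur_eps_linear (u : nat -> mor (cat a) x y) :
  eps_linear (smu c u : (nat -> mor (cat a) y z) -> _).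
Proof. by apply: sapp2r_eps_linear => i g; apply: cmu_linr. Qed.

Lemma smu_coef0 (u : nat -> mor (cat a) x y) (v : nat -> mor (cat a) y z) :
  smu c u v 0%N = kcomp (u 0%N) (v 0%N).
Proof. by rewrite /smu sapp2_coef0 cmu0. Qed.

(** Once [u] is divisible by epsilon^(n+1), the composition and [v] can contribute only their terms
    of order 0. This is how undeformed composition enters the cocycle equations. *)
Lemma smul_low (u : nat -> mor (cat a) x y) (v : nat -> mor (cat a) y z) :
  low_order u ->
  low_order (smu c u v) /\ smu c u v n.+1 = kcomp (u n.+1) (v 0%N).
Proof.
by move=> /(eps_linear_order (smul_eps_linear v))[? ->]; rewrite smu_coef0.
Qed.

Lemma smur_low (u : nat -> mor (cat a) x y) (v : nat -> mor (cat a) y z) :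
  low_order v ->
  low_order (smu c u v) /\ smu c u v n.+1 = kcomp (u 0%N) (v n.+1).
Proof.
by move=> /(eps_linear_order (smur_eps_linear u))[? ->]; rewrite smu_coef0.
Qed.

End Composition.

Arguments smul_eps_linear {a x y z} v.
Arguments smur_eps_linear {a x y z} u.

Lemma spath_eps_linear (a b : cell0 D) (p : cpath a b) x y :
  eps_linear (@spath k D c a b p x y).
Proof.
elim: p x y => [f|a1 b1 c1 p IHp q IHq] x y /=.
  by apply: sapp_eps_linear => i; apply: cfun_lin.
exact: eps_linear_comp (IHp x y) (IHq _ _).
Qed.

Lemma spath_coef0 (a b : cell0 D) (p : cpath a b) x y
    (u : nat -> mor (cat a) x y) :
  spath c p u 0%N = fmap [p] (u 0%N).
Proof.
elim: p x y u => [f|a1 b1 c1 p IHp q IHq] x y u /=.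
  by rewrite sapp_coef0 cfun0.
by rewrite IHq IHp.
Qed.

Lemma spasting_coef0 (a b : cell0 D) (S T : cpath a b) (s : pasting S T) x :
  spasting c s x 0%N = Defs.pnat (@dnat k D) s x.
Proof.
elim: s x => [s|a1 b1 S1 T1 U s IHs t IHt|a1 b1 c1 F S1 T1 s IHs
  |a1 b1 c1 S1 T1 s IHs H] x /=.
- exact: cnat0.
- by rewrite smu_coef0 IHs IHt.
- exact: IHs.
- by rewrite spath_coef0 IHs.
Qed.

Lemma spath_low (a b : cell0 D) (p : cpath a b) x y
    (u : nat -> mor (cat a) x y) : low_order u ->
  low_order (spath c p u) /\ spath c p u n.+1 = fmap [p] (u n.+1).
Proof.
by move=> /(eps_linear_order (spath_eps_linear p x y))[? ->];
  rewrite spath_coef0.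
Qed.

(* The failures of the axioms at arbitrary series, not only at constant ones:
   substituting composite series into them is what makes the identities exact. *)
Definition sassoc (a : cell0 D) (x y z w : cat a) (u : nat -> mor (cat a) x y)
    (v : nat -> mor (cat a) y z) (t : nat -> mor (cat a) z w) :
    nat -> mor (cat a) x w :=
  fun m => smu c (smu c u v) t m - smu c u (smu c v t) m.

Definition sfunct (a b : cell0 D) (p : cpath a b) (x y z : cat a)
    (u : nat -> mor (cat a) x y) (v : nat -> mor (cat a) y z) :
    nat -> mor (cat b) ([p] x) ([p] z) :=
  fun m => spath c p (smu c u v) m - smu c (spath c p u) (spath c p v) m.

Definition snatur (a b : cell0 D) (S T : cpath a b) (s : pasting S T)
    (x y : cat a) (u : nat -> mor (cat a) x y) :
    nat -> mor (cat b) ([S] x) ([T] y) :=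
  fun m => smu c (spath c S u) (spasting c s y) m
    - smu c (spasting c s x) (spath c T u) m.

Local Notation X := (obstruction c).

(** * The associator at arbitrary series *)

Section Associator.
Variables (a : cell0 D) (x y z w : cat a).

Lemma sassoc_eps_linearl (v : nat -> mor (cat a) y z)
    (t : nat -> mor (cat a) z w) :
  eps_linear (fun u : nat -> mor (cat a) x y => sassoc u v t).
Proof.
apply: eps_linear_sub; last exact: smul_eps_linear.
exact: eps_linear_comp (smul_eps_linear _) (smul_eps_linear _).
Qed.

Lemma sassoc_eps_linearm (u : nat -> mor (cat a) x y)
    (t : nat -> mor (cat a) z w) :
  eps_linear (fun v : nat -> mor (cat a) y z => sassoc u v t).
Proof.
apply: eps_linear_sub.
  exact: eps_linear_comp (smur_eps_linear _) (smul_eps_linear _).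
exact: eps_linear_comp (smul_eps_linear _) (smur_eps_linear _).
Qed.

Lemma sassoc_eps_linearr (u : nat -> mor (cat a) x y)
    (v : nat -> mor (cat a) y z) :
  eps_linear (sassoc u v : (nat -> mor (cat a) z w) -> _).
Proof.
apply: eps_linear_sub; first exact: smur_eps_linear.
exact: eps_linear_comp (smur_eps_linear _) (smur_eps_linear _).
Qed.

(** Associativity to order [n] is known on constant arrows. Applying [eps_linear_vanish] to one
    argument at a time, from the last to the first, replaces each series by its constant term. *)
Lemma sassoc_low (u : nat -> mor (cat a) x y)
    (v : nat -> mor (cat a) y z) (t : nat -> mor (cat a) z w) :
  low_order (sassoc u v t) /\
  sassoc u v t n.+1 =
    - ch0 X (scons (u 0%N) (scons (v 0%N) (scons (t 0%N) (snil w)))).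
Proof.
have tlow (f : mor (cat a) x y) (g : mor (cat a) y z) :
    low_order (sassoc (sconst f) (sconst g) t) /\
    sassoc (sconst f) (sconst g) t n.+1 = Rcat c n.+1 f g (t 0%N).
  apply: (eps_linear_vanish (sassoc_eps_linearr _ _)) => h i.
  exact: (def_assoc c f g h).
have vlow (f : mor (cat a) x y) : low_order (sassoc (sconst f) v t) /\
    sassoc (sconst f) v t n.+1 = Rcat c n.+1 f (v 0%N) (t 0%N).
  rewrite -(proj2 (tlow _ _)).
  apply: (eps_linear_vanish (sassoc_eps_linearm _ _)) => g i.
  exact: (tlow f g).1.
rewrite /= opprK -(proj2 (vlow _)).
apply: (eps_linear_vanish (sassoc_eps_linearl _ _)) => f i.
exact: (vlow f).1.
Qed.

End Associator.

(** * Functoriality and naturality failures along paths and pastings *)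

Lemma sfunct_eps_linearl (a b : cell0 D) (p : cpath a b) (x y z : cat a)
    (v : nat -> mor (cat a) y z) :
  eps_linear (fun u : nat -> mor (cat a) x y => sfunct p u v).
Proof.
apply: eps_linear_sub.
  exact: eps_linear_comp (smul_eps_linear _) (spath_eps_linear _ _ _).
exact: eps_linear_comp (spath_eps_linear _ _ _) (smul_eps_linear _).
Qed.

Lemma sfunct_eps_linearr (a b : cell0 D) (p : cpath a b) (x y z : cat a)
    (u : nat -> mor (cat a) x y) :
  eps_linear (sfunct p u : (nat -> mor (cat a) y z) -> _).
Proof.
apply: eps_linear_sub.
  exact: eps_linear_comp (smur_eps_linear _) (spath_eps_linear _ _ _).
exact: eps_linear_comp (spath_eps_linear _ _ _) (smur_eps_linear _).
Qed.

Lemma snatur_eps_linear (a b : cell0 D) (S T : cpath a b) (s : pasting S T)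
  (x y : cat a) : eps_linear (@snatur a b S T s x y).
Proof.
apply: eps_linear_sub.
  exact: eps_linear_comp (spath_eps_linear _ _ _) (smul_eps_linear _).
exact: eps_linear_comp (spath_eps_linear _ _ _) (smur_eps_linear _).
Qed.

(** On an edge the arguments are reduced to constants as for the associator. On a concatenation the
    failure splits exactly as [wp1] does. *)
Lemma sfunct_low (a b : cell0 D) (p : cpath a b) (x y z : cat a)
    (u : nat -> mor (cat a) x y) (v : nat -> mor (cat a) y z) :
  low_order (sfunct p u v) /\
  sfunct p u v n.+1 = wp1 X p (scons (u 0%N) (scons (v 0%N) (snil z))).
Proof.
elim: p x y z u v => [F|a1 b1 c1 p IHp q IHq] x y z u v.
  have vlow (f : mor (cat (src1 F)) x y) :
      low_order (sfunct (Edge F) (sconst f) v) /\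
      sfunct (Edge F) (sconst f) v n.+1 = Rfun c n.+1 f (v 0%N).
    apply: (eps_linear_vanish (sfunct_eps_linearr (Edge F) z (sconst f))).
    move=> g i.
    exact: (def_functorial c f g).
  rewrite /= -(proj2 (vlow _)).
  apply: (eps_linear_vanish (sfunct_eps_linearl (Edge F) x v)) => f i.
  exact: (vlow f).1.
(* The first summand yields the [push] term of [wp1], the second the [pull] term. *)
have e m : sfunct (Concat p q) u v m
    = spath c q (sfunct p u v) m + sfunct q (spath c p u) (spath c p v) m.
  rewrite (eps_linearB (spath_eps_linear q _ _) (fun=> erefl)).
  by rewrite /sfunct /= subrKA.
have [plow pe] := IHp _ _ _ u v.
have [qlow qe] := IHq _ _ _ (spath c p u) (spath c p v).
have [slow se] := spath_low q plow.
split=> [i im|]; first by rewrite e slow // qlow // addr0.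
by rewrite e se qe pe !spath_coef0.
Qed.

(** Each way of building a pasting gives an exact recursion for its naturality failure, matching
    that of [wp2]. The sign is that of the 2-cell coordinates of the obstruction. *)
Lemma snatur_low (a b : cell0 D) (S T : cpath a b) (s : pasting S T)
    (x y : cat a) (u : nat -> mor (cat a) x y) :
  low_order (snatur s u) /\
  snatur s u n.+1 = - wp2 X s (scons (u 0%N) (snil y)).
Proof.
elim: s x y u => [s|a1 b1 F G H s IHs t IHt|a1 b1 c1 F G H s IHs
  |a1 b1 c1 F G s IHs H] x y u.
- rewrite /= opprK.
  apply: (eps_linear_vanish (snatur_eps_linear (Cell s) x y)) => f i.
  exact: (def_natural c f).
- pose P := spasting c s; pose Q := spasting c t.
  (* Two naturality squares are stacked, and three associators supply the rebracketings between
     them; these become the three terms of [brace2]. *)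
  have e m : snatur (Vert s t) u m
      = smu c (snatur s u) (Q y) m + smu c (P x) (snatur t u) m
        - sassoc (P x) (Q x) (spath c H u) m
        + sassoc (P x) (spath c G u) (Q y) m
        - sassoc (spath c F u) (P y) (Q y) m.
    rewrite (eps_linearB (smul_eps_linear _) (fun=> erefl)).
    rewrite (eps_linearB (smur_eps_linear _) (fun=> erefl)).
    rewrite /snatur /sassoc /= -/P -/Q !opprB.
    (* The permutation puts the differences in telescoping order, so that [subrK] cancels
       neighbours. *)
    by rewrite [RHS](ACl (5*1*4*2*3))%AC /= !addrA !subrK.
  have [slow se] := IHs x y u; have [tlow te] := IHt x y u.
  have [sTlow sTe] := smul_low (Q y) slow.
  have [Stlow Ste] := smur_low (P x) tlow.
  have [a1low a1e] := sassoc_low (P x) (Q x) (spath c H u).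
  have [a2low a2e] := sassoc_low (P x) (spath c G u) (Q y).
  have [a3low a3e] := sassoc_low (spath c F u) (P y) (Q y).
  split=> [i im|].
    by rewrite e sTlow // Stlow // a1low // a2low // a3low // !(addr0, subr0).
  rewrite e sTe Ste a1e a2e a3e se te /P /Q !spasting_coef0 !spath_coef0 /=.
  rewrite brace2_1E /= kcompNl kcompNr !opprK.
  rewrite /npush /npull.
  move: (Rcat _ _ _ _ _) => R1; move: (Rcat _ _ _ _ _) => R2.
  move: (Rcat _ _ _ _ _) => R3; rewrite !opprD !opprK !addrA.
  by rewrite [LHS](ACl (1*2*4*3*5))%AC.
(* Precomposition only evaluates the failure at the series obtained from [F]. *)
- have [slow se] := IHs _ _ (spath c F u).
  by rewrite spath_coef0 in se; split.
(* Moving [H] past the two compositions costs two functoriality failures of [H], which become the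
   two terms of [brace1]. *)
- have e m : snatur (Post s H) u m
      = spath c H (snatur s u) m - sfunct H (spath c F u) (spasting c s y) m
        + sfunct H (spasting c s x) (spath c G u) m.
    rewrite (eps_linearB (spath_eps_linear _ _ _) (fun=> erefl)).
    rewrite /snatur /sfunct /= opprB.
    by rewrite [RHS](ACl (2*1*3))%AC /= !addrA !subrK.
  have [slow se] := IHs x y u.
  have [Hslow Hse] := spath_low H slow.
  have [f1low f1e] := sfunct_low H (spath c F u) (spasting c s y).
  have [f2low f2e] := sfunct_low H (spasting c s x) (spath c G u).
  split=> [i im|].
    by rewrite e Hslow // f1low // f2low // !(addr0, subr0).
  rewrite e Hse se f1e f2e !spasting_coef0 !spath_coef0 /=.
  rewrite brace1_1E fmapN.
  by rewrite /push !opprD opprK addrA.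
Qed.

(** * The obstruction lies in the complex, and its differential vanishes on cells of each
    dimension *)

Lemma obstruction_in_complex : in_complex X.
Proof.
(* The 3-cell coordinates have degree 0 and carry no condition. The others are, up to sign,
   coefficients of the failures at constant series, hence linear in each argument by
   [eps_linear_sconst]. *)
split=> [a|F|s|g] x //=.
- split=> [z y [w [g [v [h e]]]]|z f].
    case: y / e; apply: linear_opp.
    exact: eps_linear_sconst (sassoc_eps_linearl _ (sconst g) (sconst h)) _.
  split=> [w y [v [h e]]|w g].
    case: y / e; apply: linear_opp.
    exact: eps_linear_sconst (sassoc_eps_linearm (sconst f) (sconst h)) _.
  split=> // v y e; case: y / e; apply: linear_opp.
  exact: eps_linear_sconst (sassoc_eps_linearr _ (sconst f) (sconst g)) _.
- split=> [z y [w [g e]]|z f].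
    case: y / e.
    exact: eps_linear_sconst (sfunct_eps_linearl (Edge F) _ (sconst g)) _.
  split=> // w y e; case: y / e.
  exact: eps_linear_sconst (sfunct_eps_linearr (Edge F) _ (sconst f)) _.
- split=> // z y e; case: y / e; apply: linear_opp.
  exact: eps_linear_sconst (snatur_eps_linear (Cell s) _ _) _.
Qed.

(** The pentagon: the five rebracketings of a fourfold product, taken with alternating signs,
    cancel. *)
Lemma obstruction_closed0 (a : cell0 D) (y z : cat a) (t : str 4 y z) :
  ch0 (dD X) t = 0.
Proof.
case: t => x1 [f1 [x2 [f2 [x3 [f3 [x4 [f4 e]]]]]]]; case: z / e.
apply: etrans (congr1 -%R (dC3E (@ch0 _ _ _ X a) f1 f2 f3 f4)) _.
pose u1 := sconst f1; pose u2 := sconst f2.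
pose u3 := sconst f3; pose u4 := sconst f4.
have e : smu c u1 (sassoc u2 u3 u4) n.+1 - sassoc (smu c u1 u2) u3 u4 n.+1
  + sassoc u1 (smu c u2 u3) u4 n.+1 - sassoc u1 u2 (smu c u3 u4) n.+1
  + smu c (sassoc u1 u2 u3) u4 n.+1 = 0.
  rewrite (eps_linearB (smul_eps_linear _) (fun=> erefl)).
  rewrite (eps_linearB (smur_eps_linear _) (fun=> erefl)) /sassoc !opprB.
  by rewrite [LHS](ACl (3*1*4*2*5))%AC /= !addrA !subrK subrr.
have [low234 e234] := sassoc_low u2 u3 u4.
have [low123 e123] := sassoc_low u1 u2 u3.
move: e; rewrite (smur_low u1 low234).2 (smul_low u4 low123).2 e234 e123.
(* The identity replaces the 0 in the goal, so only signs remain to be compared. *)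
rewrite !(sassoc_low _ _ _).2 !smu_coef0 kcompNl kcompNr => <-.
by rewrite !opprD !opprK.
Qed.

(** A hexagon relates the image of the associator of the source to the associator of the images; its
    other four sides are functoriality failures. *)
Lemma obstruction_closed1 (F : cell1 D) (y z : cat (src1 F)) (t : str 3 y z) :
  ch1 (dD X) t = 0.
Proof.
case: t => x1 [f1 [x2 [f2 [x3 [f3 e]]]]]; case: z / e.
apply: etrans (congr1 (fun w => _ + w) (dC2E (@ch1 _ _ _ X F) f1 f2 f3)) _.
pose u1 := sconst f1; pose u2 := sconst f2; pose u3 := sconst f3.
pose p := Edge F.
have e : spath c p (sassoc u1 u2 u3) n.+1
  - sassoc (spath c p u1) (spath c p u2) (spath c p u3) n.+1
  + smu c (spath c p u1) (sfunct p u2 u3) n.+1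
  - sfunct p (smu c u1 u2) u3 n.+1 + sfunct p u1 (smu c u2 u3) n.+1
  - smu c (sfunct p u1 u2) (spath c p u3) n.+1 = 0.
  rewrite (eps_linearB (spath_eps_linear _ _ _) (fun=> erefl)).
  rewrite (eps_linearB (smul_eps_linear _) (fun=> erefl)).
  rewrite (eps_linearB (smur_eps_linear _) (fun=> erefl)).
  rewrite /sassoc /sfunct !opprB.
  by rewrite [LHS](ACl (4*1*5*3*2*6))%AC /= !addrA !subrK subrr.
have [alow ae] := sassoc_low u1 u2 u3.
have [low12 e12] := sfunct_low p u1 u2.
have [low23 e23] := sfunct_low p u2 u3.
move: e; rewrite (spath_low p alow).2 ae (smur_low _ low23).2 e23.
rewrite (smul_low _ low12).2 e12 !(sfunct_low _ _ _).2 (sassoc_low _ _ _).2.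
rewrite !smu_coef0 !spath_coef0 fmapN opprK => <-.
by rewrite /push /pull !addrA.
Qed.

(** Naturality at a composite is compared with naturality at its factors. Three associators give the
    brace term, two functoriality failures the [wp1] terms, and three naturality failures the
    differential. *)
Lemma obstruction_closed2 (s : cell2 D) (y z : cat (dom2 s)) (t : str 2 y z) :
  ch2 (dD X) t = 0.
Proof.
case: t => x1 [f [x2 [g e]]]; case: z / e.
apply: etrans (congr2 (fun v w => v + _ - _ - w)
  (brace1_2E (dnat s) (@ch0 _ _ _ X (cod2 s)) f g)
  (dC1E (@ch2 _ _ _ X s) f g)) _.
pose u := sconst f; pose v := sconst g.
pose P := spasting c (Cell s).
pose Su := spath c (src2 s) u; pose Sv := spath c (src2 s) v.
pose Tu := spath c (tgt2 s) u; pose Tv := spath c (tgt2 s) v.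
have e : sassoc (P y) Tu Tv n.+1 - sassoc Su (P x1) Tv n.+1
  + sassoc Su Sv (P x2) n.+1
  + smu c (sfunct (src2 s) u v) (P x2) n.+1
  - smu c (P y) (sfunct (tgt2 s) u v) n.+1
  + smu c Su (snatur (Cell s) v) n.+1 - snatur (Cell s) (smu c u v) n.+1
  + smu c (snatur (Cell s) u) Tv n.+1 = 0.
  rewrite !(eps_linearB (smul_eps_linear _) (fun=> erefl)).
  rewrite !(eps_linearB (smur_eps_linear _) (fun=> erefl)).
  rewrite /sassoc /snatur !opprB.
  by rewrite [LHS](ACl (4*3*6*2*8*1*5*7))%AC /= !addrA !subrK subrr.
have [Slow Se] := sfunct_low (src2 s) u v.
have [Tlow Te] := sfunct_low (tgt2 s) u v.
have [ulow ue] := snatur_low (Cell s) u.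
have [vlow ve] := snatur_low (Cell s) v.
move: e; rewrite (smul_low _ Slow).2 (smur_low _ Tlow).2.
rewrite (smul_low _ ulow).2 (smur_low _ vlow).2 ue ve Se Te.
rewrite !(sassoc_low _ _ _).2 (snatur_low _ _).2.
rewrite smu_coef0 /P /Su /Sv /Tu /Tv !spath_coef0 !spasting_coef0.
rewrite kcompNl kcompNr.
(* X is generalized because opprK would unfold it to its coordinates. *)
move: X => X' <-; rewrite !opprK opprD opprB !addrA /npush /npull.
by rewrite [LHS](ACl (2*1*3*4*5*7*6*8))%AC.
Qed.

(** The naturality failures of the two pastings differ exactly by the commutator of their difference
    with the composite functors. *)
Lemma obstruction_closed3 (g : cell3 D) (y z : cat (dom3 g)) (t : str 1 y z) :
  ch3 (dD X) t = 0.
Proof.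
case: t => x1 [f e]; case: z / e.
apply: etrans (congr1 (fun w => _ + w) (dC0E (@ch3 _ _ _ X g) f)) _.
pose u := sconst f.
pose P := spasting c (src3 g); pose Q := spasting c (tgt3 g).
pose Su := spath c (bsrc3 g) u; pose Tu := spath c (btgt3 g) u.
pose R x := fun m => P x m - Q x m.
(* The 3-cell equation holds to order [n], so in order [n+1] the products with [R] involve only the
   undeformed functors. *)
have Rlow x : low_order (R x) by move=> i /(def_comm c x).
have e : - snatur (src3 g) u n.+1 + snatur (tgt3 g) u n.+1
  + (smu c Su (R x1) n.+1 - smu c (R y) Tu n.+1) = 0.
  rewrite (eps_linearB (smul_eps_linear _) (fun=> erefl)).
  rewrite (eps_linearB (smur_eps_linear _) (fun=> erefl)).
  rewrite /snatur !opprB addrA.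
  by rewrite [LHS](ACl (1*3*2*4))%AC /= !addrA !subrK subrr.
move: e; rewrite !(snatur_low _ _).2 (smur_low _ (Rlow _)).2.
by rewrite (smul_low _ (Rlow _)).2 /Su /Tu !spath_coef0 opprK => <-.
Qed.

End Obstruction.

Theorem theorem5p17 (k : comPzRingType) (D : pasting_diagram k)
    (hD : single_composition D) (n : nat) (c : deformation D n) :
  cocycle (obstruction c).
Proof.
split; first exact: obstruction_in_complex.
split; [exact: obstruction_closed0 | exact: obstruction_closed1 |
  exact: obstruction_closed2 | exact: obstruction_closed3].
Qed.
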